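(* Let the $P$-representation and the $P^-$-representation be generated by the same sequence $P=(\varphi_n)_{n=0}^\infty$, and let $F_P\colon(0,1]\to(0,1)\setminus IS^{P^-}$ be the function $F_P\left(\Delta^P_{p_1p_2\ldots}\right)=\Delta^{P^-}_{p_1p_2\ldots}$. If $E\subseteq(0,1]$ is Lebesgue-measurable, then its image $F_P(E)$ under $F_P$ is also Lebesgue-measurable, and $\lambda(F_P(E))=\lambda(E)$.
   Context: $\mathbb{N}=\{1,2,3,\dots\}$ and $\lambda$ is Lebesgue measure. $P=(\varphi_n)_{n=0}^\infty$ is a fixed sequence with $\varphi_0\in\mathbb{N}$ a constant and $\varphi_n\colon\mathbb{N}^n\to\mathbb{N}$ a function for each $n\ge1$. $P$-representation: it is known that each $x\in(0,1]$ can be uniquely written as $$x=\sum_{n=0}^{\infty}\frac{r_0 r_1 \cdots r_n}{(p_1-1)p_1\cdots(p_n-1)p_n\, p_{n+1}},$$ with $r_0=\varphi_0$, $r_n=\varphi_n(p_1,\ldots,p_n)$, $p_n\in\mathbb{N}$ and $p_n\ge r_{n-1}+1$ for all $n\in\mathbb{N}$ (the $n=0$ term is $r_0/p_1$). This is denoted $x=\Delta^P_{p_1p_2\ldots}$. $P^-$-representation: for natural numbers $q_n$ with $r_0=\varphi_0$, $r_n=\varphi_n(q_1,\ldots,q_n)$ and $q_n\ge r_{n-1}+1$ for all $n\in\mathbb{N}$, let $$\Delta^{P^-}_{q_1q_2\ldots}=\sum_{n=0}^{\infty}\frac{(-1)^n r_0 r_1 \cdots r_n}{(q_1-1)q_1\cdots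 (q_n-1)q_n (q_{n+1}-1)}\in(0,1)$$ (the $n=0$ term is $r_0/(q_1-1)$). A $P^-$-cylinder $\Delta^{P^-}_{c_1\ldots c_k}$ of rank $k\ge1$ is the set, when non-empty, of all $x\in(0,1)$ having such a representation with $q_1=c_1,\ldots,q_k=c_k$. $IS^{P^-}$ is the set of all infima and suprema of all $P^-$-cylinders. Every $x\in(0,1)\setminus IS^{P^-}$ has a unique $P^-$-representation, points of $IS^{P^-}$ have none, and $F_P$ is a bijection from $(0,1]$ onto $(0,1)\setminus IS^{P^-}$. *)

(* Defs.v *)
From HB Require Import structures.
From mathcomp Require Import all_boot all_order all_algebra.
From mathcomp Require Import all_classical all_reals all_analysis.

Set Implicit Arguments.
Unset Strict Implicit.
Unset Printing Implicit Defensive.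

Import Order.TTheory GRing.Theory Num.Theory.
Import numFieldNormedType.Exports.

Local Open Scope classical_set_scope.
Local Open Scope ring_scope.

(* A sequence P = (phi_n)_{n >= 0} with phi_n : N^n -> N, N = {1, 2, ...}.
   Numbers are encoded in nat; [rule_pos] says that phi_n maps tuples of
   positive integers to positive integers. The values of phi_n on tuples
   containing 0 are never used. *)
Definition rule := forall n : nat, n.-tuple nat -> nat.

Definition rule_pos (phi : rule) : Prop :=
  forall (n : nat) (t : n.-tuple nat),
    (forall i : 'I_n, (0 < tnth t i)%N) -> (0 < phi n t)%N.

(* Digit sequences are indexed from 0: [p i] stands for the digit p_{i+1}.
   Hence r_n = phi_n(p_1, ..., p_n) depends on p 0, ..., p n.-1 only. *)
Definition r (phi : rule) (p : nat -> nat) (n : nat) : nat :=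
  phi n [tuple p i | i < n].

(* p_{n+1} >= r_n + 1 for all n >= 0 *)
Definition admissible (phi : rule) (p : nat -> nat) : Prop :=
  forall n : nat, (r phi p n + 1 <= p n)%N.

Section representations.
Context {R : realType}.
Implicit Types (phi : rule) (p : nat -> nat).

Definition P_term phi p (n : nat) : R :=
  (\prod_(i < n.+1) (r phi p i)%:R) /
  ((\prod_(i < n) (((p i)%:R - 1) * (p i)%:R)) * (p n)%:R).

Definition Pminus_term phi p (n : nat) : R :=
  (-1) ^+ n * (\prod_(i < n.+1) (r phi p i)%:R) /
  ((\prod_(i < n) (((p i)%:R - 1) * (p i)%:R)) * ((p n)%:R - 1)).

Definition DeltaP phi p : R := limn (series (P_term phi p)).

Definition DeltaPminus phi p : R := limn (series (Pminus_term phi p)).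

(* The digit sequence of the P-representation of x. It exists and is unique
   for x in ]0, 1]; otherwise an arbitrary sequence is returned. *)
Definition P_digits phi (x : R) : nat -> nat :=
  xget (fun=> 1%N) [set p | admissible phi p /\ DeltaP phi p = x].

(* F_P (Delta^P_{p_1 p_2 ...}) = Delta^{P^-}_{p_1 p_2 ...} *)
Definition F_P phi (x : R) : R := DeltaPminus phi (P_digits phi x).

(* Lebesgue measurability: membership in the domain of
   [completed_lebesgue_measure], i.e., Caratheodory measurability for the
   outer measure induced by interval length (not just Borel measurability). *)
Definition lebesgue_measurable (E : set R) : Prop :=
  ((@wlength R idfun)^*)%mu.-cara.-measurable E.

End representations.

(* Main.v *)
Require Import Defs.
From HB Require Import structures.
From mathcomp Require Import all_boot all_order all_algebra.
From mathcomp Require Import all_classical all_reals all_analysis.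
From mathcomp Require Import ring lra.
Import Order.TTheory GRing.Theory Num.Theory.
Import numFieldNormedType.Exports.
Local Open Scope classical_set_scope.
Local Open Scope ring_scope.

(** Both representations are instances of one construction.  A finite word of
admissible digits [p_1 ... p_n] determines a P-interval and a P^- -interval of
the same length, the product of the ratios [r_(i-1) / ((p_i - 1) p_i)].  In
either family the children of an interval are pairwise disjoint subintervals
of it; the children are laid out from right to left as the digit grows, except
that the P^- -family reverses this order at every odd level, as dictated by the
alternating signs.  Since [p_i >= r_(i-1) + 1 >= 2], the ratios are at most
1/2, so the lengths tend to 0 uniformly and a point is determined by the nested
intervals containing it ([cylinders_Delta]); conversely the sum of the series
attached to an admissible sequence lies in all its intervals
([Delta_cylinder]).  Consequently [F_P] sends a point of a P-interval to a
point of the P^- -interval with the same word ([F_P_cylinder]).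

The analytic heart is [outer_measure_transfer].  If every point of [T] shares
its digit sequence with a point of [S], cover [S] by an open set [U] of almost
the same outer measure.  The shortest words whose intervals (in the family of
[S]) lie inside [U] give disjoint intervals, of total length at most that of
[U]; the intervals with the same words in the other family cover [T] and have
the same total length.  So the outer measure of [T] is at most that of [S].
Applied in both directions, this says that neither the image nor the preimage
under [F_P] increases outer measure, hence [F_P] preserves it.

For measurability, [F_P] maps ]0, 1] onto the set of points which belong to a
P^- -interval of every level, a Borel set ([measurable_image_F_P]).  To check
the Caratheodory criterion for [F_P @` E] on a test set [A], split [A] along
this Borel set; the part outside it misses [F_P @` E], and the part inside is
handled by pulling it back, using the criterion for [E], and pushing the two
pieces forward again. *)

(** * Intervals attached to finite words of digits *)

Section Cylinders.
Context {R : realType} (phi : rule) (hphi : rule_pos phi).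
Implicit Types (alt : bool) (p q : nat -> nat) (n : nat) (x y : R).

Definition admissible_upto p n := forall i, (i < n)%N -> (r phi p i + 1 <= p i)%N.

(** Common length of the P-interval and of the P^- -interval of rank [n]. *)
Definition width p n : R :=
  \prod_(i < n) ((r phi p i)%:R / (((p i)%:R - 1) * (p i)%:R)).

(** The boolean [alt] selects the representation: [false] for P, [true] for
P^-.  The latter reverses the order of the subintervals at odd levels. *)
Definition flipped alt n := alt && odd n.

Definition low alt p n : R :=
  \sum_(i < n) width p i *
    (if flipped alt i then 1 - (r phi p i)%:R / ((p i)%:R - 1)
     else (r phi p i)%:R / (p i)%:R).

(** The interval is taken half-open in both families, so that the intervals of
equal rank are disjoint whatever the orientation.  A point belonging to the
intervals of all ranks of an admissible sequence is never a right end point in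
the alternating case, so this convention does not change which points have a
P^- -representation. *)
Definition cylinder alt p n : set R :=
  `]low alt p n, low alt p n + width p n]%classic.

Definition term alt : (nat -> nat) -> nat -> R :=
  if alt then Pminus_term phi else P_term phi.

Definition Delta alt p : R := limn (series (term alt p)).

Lemma eq_r p q n : (forall i, (i < n)%N -> p i = q i) -> r phi p n = r phi q n.
Proof.
by move=> pq; rewrite /r; congr (phi n _); apply: eq_mktuple => i; exact: pq.
Qed.

Lemma eq_width p q n :
  (forall i, (i < n)%N -> p i = q i) -> width p n = width q n.
Proof.
move=> pq; apply: eq_bigr => i _; rewrite pq// (@eq_r p q)// => j ji.
by rewrite pq// (ltn_trans ji).
Qed.

Lemma eq_low alt p q n :
  (forall i, (i < n)%N -> p i = q i) -> low alt p n = low alt q n.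
Proof.
move=> pq; apply: eq_bigr => i _; have pqi j : (j < i)%N -> p j = q j.
  by move=> ji; rewrite pq// (ltn_trans ji).
by rewrite pq// (eq_r _ _ _ pqi) (eq_width _ _ _ pqi).
Qed.

Lemma eq_cylinder alt p q n :
  (forall i, (i < n)%N -> p i = q i) -> cylinder alt p n = cylinder alt q n.
Proof.
by move=> pq; rewrite /cylinder (eq_low _ _ _ _ pq) (eq_width _ _ _ pq).
Qed.

Lemma eq_admissible_upto p q n : (forall i, (i < n)%N -> p i = q i) ->
  admissible_upto p n -> admissible_upto q n.
Proof.
move=> pq ap i lin; rewrite -pq// -(@eq_r p q) ?ap// => j ji.
by rewrite pq// (ltn_trans ji).
Qed.

Lemma admissible_upto_le p m n :
  (m <= n)%N -> admissible_upto p n -> admissible_upto p m.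
Proof. by move=> mn ap i im; apply: ap; rewrite (leq_trans im). Qed.

Lemma admissible_admissible_upto p n : admissible phi p -> admissible_upto p n.
Proof. by move=> ap i _; exact: ap. Qed.

Lemma r_gt0 p n : admissible_upto p n -> (0 < r phi p n)%N.
Proof.
by move=> ap; apply: hphi => i; rewrite tnth_mktuple (leq_trans _ (ap i _))// addn1.
Qed.

Lemma digit_bounds p n : admissible_upto p n.+1 ->
  1 <= (r phi p n)%:R :> R /\ (r phi p n)%:R + 1 <= (p n)%:R :> R.
Proof.
move=> ap; split; last by rewrite natr1 ler_nat -addn1 ap.
by rewrite ler1n r_gt0//; exact: admissible_upto_le ap.
Qed.

Lemma widthS p n :
  width p n.+1 = width p n * ((r phi p n)%:R / (((p n)%:R - 1) * (p n)%:R)).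
Proof. by rewrite /width big_ord_recr. Qed.

Lemma lowS alt p n : low alt p n.+1 = low alt p n + width p n *
  (if flipped alt n then 1 - (r phi p n)%:R / ((p n)%:R - 1)
   else (r phi p n)%:R / (p n)%:R).
Proof. by rewrite /low big_ord_recr. Qed.

Lemma highS alt p n : admissible_upto p n.+1 ->
  low alt p n.+1 + width p n.+1 = low alt p n + width p n *
  (if flipped alt n then 1 - (r phi p n)%:R / (p n)%:R
   else (r phi p n)%:R / ((p n)%:R - 1)).
Proof.
move=> /digit_bounds[]; rewrite lowS widthS -addrA -mulrDr.
set a := (r _ _ _)%:R; set b := (p n)%:R => a1 ab.
have b0 : b != 0 by lra.
have b1 : b - 1 != 0 by lra.
by congr (_ + _ * _); case: ifP => _; field; rewrite b0 b1.
Qed.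

Lemma width_gt0 p n : admissible_upto p n -> 0 < width p n.
Proof.
move=> ap; apply: prodr_gt0 => i _.
have [] := @digit_bounds p i _.
  by apply: admissible_upto_le ap.
set a := (r _ _ _)%:R; set b := (p i)%:R => a1 ab.
by rewrite divr_gt0 ?mulr_gt0; lra.
Qed.

Lemma width_le p n : admissible_upto p n -> width p n <= 2^-1 ^+ n.
Proof.
elim: n => [|n IH] ap; first by rewrite /width big_ord0 expr0.
have apn : admissible_upto p n by exact: admissible_upto_le ap.
rewrite widthS exprSr; have [] := digit_bounds _ _ ap.
set a := (r _ _ _)%:R; set b := (p n)%:R => a1 ab.
have ? := width_gt0 _ _ apn.
apply: ler_pM; [exact: ltW| | exact: IH|].
  by rewrite divr_ge0 ?mulr_ge0; lra.
by rewrite ler_pdivrMr ?mulr_gt0; nra.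
Qed.

Lemma low_le alt p n : admissible_upto p n.+1 -> low alt p n <= low alt p n.+1.
Proof.
move=> ap; have := digit_bounds _ _ ap.
have w0 := width_gt0 _ _ (admissible_upto_le _ _ _ (leqnSn n) ap).
rewrite lowS; set a := (r _ _ _)%:R; set b := (p n)%:R => -[a1 ab].
rewrite lerDl mulr_ge0 ?(ltW w0)//; case: ifP => _.
  by rewrite subr_ge0 ler_pdivrMr; lra.
by rewrite divr_ge0; lra.
Qed.

(** The strict inequality fails at reversed levels: there the digit
[r phi p n + 1] gives an interval with the same left end point. *)
Lemma low_lt alt p n : ~~ flipped alt n -> admissible_upto p n.+1 ->
  low alt p n < low alt p n.+1.
Proof.
move=> /negbTE nf ap; have := digit_bounds _ _ ap.
have w0 := width_gt0 _ _ (admissible_upto_le _ _ _ (leqnSn n) ap).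
rewrite lowS nf; set a := (r _ _ _)%:R; set b := (p n)%:R => -[a1 ab].
by rewrite ltrDl mulr_gt0// divr_gt0; lra.
Qed.

Lemma high_le alt p n : admissible_upto p n.+1 ->
  low alt p n.+1 + width p n.+1 <= low alt p n + width p n.
Proof.
move=> ap; have := digit_bounds _ _ ap.
have w0 := width_gt0 _ _ (admissible_upto_le _ _ _ (leqnSn n) ap).
rewrite highS//; set a := (r _ _ _)%:R; set b := (p n)%:R => -[a1 ab].
rewrite lerD2l ler_piMr ?(ltW w0)//; case: ifP => _.
  by rewrite gerBl divr_ge0; lra.
by rewrite ler_pdivrMr; lra.
Qed.

Lemma cylinder_le alt p m n : (m <= n)%N -> admissible_upto p n ->
  cylinder alt p n `<=` cylinder alt p m.
Proof.
elim: n => [|n IH]; first by rewrite leqn0 => /eqP -> _ x.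
rewrite leq_eqVlt => /predU1P[-> _ x //|mn ap].
apply: subset_trans (IH mn (admissible_upto_le _ _ _ (leqnSn n) ap)).
move=> x; rewrite /cylinder/= !in_itv/= => /andP[lx xh].
by rewrite (le_lt_trans (low_le _ _ _ ap) lx) (le_trans xh (high_le _ _ _ ap)).
Qed.

(** Below a common interval, a larger digit gives an interval lying wholly to
one side: to the left normally, to the right when the order is reversed.  Both
cases rest on [r / (q n - 1) <= r / p n], valid because [p n <= q n - 1]. *)
Lemma cylinder_disjoint alt p q n x :
  admissible_upto p n.+1 -> admissible_upto q n.+1 ->
  (forall i, (i < n)%N -> p i = q i) -> (p n < q n)%N ->
  cylinder alt p n.+1 x -> cylinder alt q n.+1 x -> False.
Proof.
move=> ap aq pq pqn; rewrite /cylinder/= !in_itv/= !highS// !lowS.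
rewrite -(eq_r _ _ _ pq) -(eq_low _ _ _ _ pq) -(eq_width _ _ _ pq).
have [] := digit_bounds _ _ ap.
have w0 := width_gt0 _ _ (admissible_upto_le _ _ _ (leqnSn n) ap).
have : (p n)%:R + 1 <= (q n)%:R :> R by rewrite natr1 ler_nat.
set a := (r _ _ _)%:R; set b := (p n)%:R; set c := (q n)%:R => bc a1 ab.
have abc : a / (c - 1) <= a / b.
  by rewrite ler_pM2l ?lef_pV2 ?posrE; lra.
have := ler_wpM2l (ltW w0) abc.
by case: ifP => _; rewrite ?mulrBr => ? /andP[? ?] /andP[? ?]; lra.
Qed.

Lemma cylinder_inj alt p q n x : admissible_upto p n -> admissible_upto q n ->
  cylinder alt p n x -> cylinder alt q n x ->
  forall i, (i < n)%N -> p i = q i.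
Proof.
move=> ap aq px qx; elim/ltn_ind => i IH lin.
have [api aqi] : admissible_upto p i.+1 /\ admissible_upto q i.+1.
  by split; [apply: admissible_upto_le ap|apply: admissible_upto_le aq].
have pq j : (j < i)%N -> p j = q j.
  by move=> ji; apply: IH => //; exact: ltn_trans lin.
have qp j : (j < i)%N -> q j = p j by move=> ji; rewrite pq.
have pxi : cylinder alt p i.+1 x by apply: cylinder_le px.
have qxi : cylinder alt q i.+1 x by apply: cylinder_le qx.
have [pqi|qpi|//] := ltngtP (p i) (q i); exfalso.
- exact: (cylinder_disjoint _ _ _ _ _ api aqi pq pqi pxi qxi).
- exact: (cylinder_disjoint _ _ _ _ _ aqi api qp qpi qxi pxi).
Qed.

(** The partial sums are end points of the successive intervals: always the
left one for P, alternately the left and the right one for P^-.  This is what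
identifies the intervals with the two series. *)
Lemma series_term alt p n : admissible_upto p n ->
  series (term alt p) n = low alt p n + (flipped alt n)%:R * width p n.
Proof.
elim: n => [|n IH] ap.
  by rewrite seriesEord/= big_ord0 /low big_ord0 /flipped andbF mul0r addr0.
rewrite seriesSr IH; last exact: admissible_upto_le ap.
move=> {IH}; have [] := digit_bounds _ _ ap.
set a := (r _ _ _)%:R; set b := (p n)%:R => a1 ab.
have b0 : b != 0 by lra.
have b1 : b - 1 != 0 by lra.
have -> : term alt p n = width p n * (if alt then (-1) ^+ n * (a / (b - 1))
    else a / b).
  rewrite /term; case: alt.
    by rewrite /Pminus_term big_ord_recr/= /width prodf_div invfM -/a -/b; ring.
  by rewrite /P_term big_ord_recr/= /width prodf_div invfM -/a -/b; ring.
rewrite lowS widthS -/a -/b /flipped -signr_odd.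
by case: alt => /=; case: (odd n) => /=; field; rewrite ?b0 ?b1.
Qed.

Lemma near_series alt p n x : admissible_upto p n -> cylinder alt p n x ->
  `|x - series (term alt p) n| <= 2^-1 ^+ n.
Proof.
move=> ap; rewrite /cylinder/= in_itv/= series_term// => /andP[? ?].
have := width_le _ _ ap; have := width_gt0 _ _ ap.
move=> ? ?; case: flipped => /=; rewrite ?mul1r ?mul0r ler_norml.
  by apply/andP; split; lra.
by apply/andP; split; lra.
Qed.

(** * Sums of the series and nested intervals *)

Lemma cylinders_Delta alt p x : admissible phi p ->
  (forall n, cylinder alt p n x) -> Delta alt p = x.
Proof.
move=> ap px; apply/cvg_lim => //.
apply/subr_cvg0/norm_cvg0P.
apply: (@squeeze_cvgr _ _ _ _ (fun=> 0) (fun n => 2^-1 ^+ n)).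
- near=> n; rewrite normr_ge0/= distrC near_series//.
- exact: cvg_cst.
- by apply: cvg_expr; rewrite ger0_norm; lra.
Unshelve. all: end_near. Qed.

(** The closures of the nested intervals meet by completeness.  The left end
points increase strictly at least once in two steps, because two consecutive
levels are never both reversed; so the common point avoids every left end point
and belongs to the half-open intervals themselves. *)
Lemma Delta_cylinder alt p n : admissible phi p -> cylinder alt p n (Delta alt p).
Proof.
move=> ap; have apm m := @admissible_admissible_upto p m ap.
have nl : nondecreasing_seq (low alt p) by apply/nondecreasing_seqP => k; exact: low_le.
pose high k := low alt p k + width p k.
have nh : nonincreasing_seq high by apply/nonincreasing_seqP => k; exact: high_le.
have lh k m : low alt p k <= high m.
  apply: (@le_trans _ _ (high (maxn k m))); last by apply: nh; rewrite leq_maxr.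
  apply: (@le_trans _ _ (low alt p (maxn k m))).
    by apply: nl; rewrite leq_maxl.
  by rewrite lerDl ltW// width_gt0.
have hs : has_sup (range (low alt p)).
  by split; [exists (low alt p 0), 0%N|exists (high 0%N) => _ [k _ <-]].
pose x := sup (range (low alt p)).
have lx k : low alt p k <= x by apply: ub_le_sup; [case: hs|exists k].
have xh k : x <= high k.
  by apply: ge_sup; [case: hs|move=> _ [m _ <-]].
suff px m : cylinder alt p m x by rewrite (cylinders_Delta _ _ _ ap px).
(* Two ranks further on, the left end point has moved. *)
rewrite /cylinder/= in_itv/= xh andbT.
apply: lt_le_trans (lx m.+2).
have [f|nf] := boolP (flipped alt m); last first.
  by rewrite (lt_le_trans (low_lt _ _ _ nf (apm _)))// low_le.
rewrite (le_lt_trans (low_le _ _ _ (apm m.+1)))// low_lt//.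
by move: f; rewrite /flipped => /andP[-> /=] ->.
Qed.

Lemma lebesgue_measure_cylinder alt p n : admissible_upto p n ->
  lebesgue_measure (cylinder alt p n) = (width p n)%:E.
Proof.
move=> ap; rewrite /cylinder lebesgue_measure_itv/= lte_fin.
by rewrite ltrDl width_gt0// -EFinB addrC addKr.
Qed.

Lemma small_cylinder alt p x (U : set R) : admissible phi p ->
  (forall n, cylinder alt p n x) -> open U -> U x ->
  exists n, cylinder alt p n `<=` U.
Proof.
move=> ap px oU Ux.
have [e /= e0 eU] : nbhs_ball x U by apply/nbhs_ballP; exact: open_nbhs_nbhs.
have : \forall n \near \oo, `|(2^-1 : R) ^+ n| < e.
  apply: cvgr0_norm_lt => //.
  by apply: cvg_expr; rewrite ger0_norm; lra.
move=> [n _ /(_ n (leqnn n)) /=]; rewrite ger0_norm ?exprn_ge0 ?invr_ge0// => ne.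
exists n => y yn; apply: eU; rewrite /ball/=.
have := px n; move: yn; rewrite /cylinder/= !in_itv/= => /andP[? ?] /andP[? ?].
have := width_le p n (admissible_admissible_upto p n ap) => ?.
by rewrite ltr_norml; apply/andP; split; lra.
Qed.

(** The P-intervals of rank [n.+1] exhaust their parent: writing
[x = low + width * t] with [0 < t <= 1], the next digit [k] must satisfy
[r / k < t <= r / (k - 1)], hence is the integer part of [r / t] plus one. *)
Lemma next_P_digit p n x : admissible_upto p n -> cylinder false p n x ->
  exists q, admissible_upto q n.+1 /\ cylinder false q n.+1 x.
Proof.
move=> ap; rewrite /cylinder/= in_itv/= => /andP[lx xh].
have w0 := width_gt0 _ _ ap.
pose a := r phi p n; pose t := (x - low false p n) / width p n.
have a0 : 1 <= a%:R :> R by rewrite ler1n; exact: r_gt0.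
have t0 : 0 < t by rewrite divr_gt0// subr_gt0.
have t1 : t <= 1 by rewrite ler_pdivrMr// mul1r lerBlDl.
have xE : x = low false p n + width p n * t.
  by rewrite /t mulrCA mulfV ?gt_eqF// mulr1 addrC subrK.
pose d := Num.trunc (a%:R / t).
have at0 : 0 <= a%:R / t by rewrite divr_ge0//; lra.
have ad : (a <= d)%N.
  by rewrite truncn_ge_nat// ler_pdivlMr// ler_piMr//; lra.
have /andP[dt td] : d%:R <= a%:R / t < d.+1%:R by exact: truncn_itv.
pose q i := if i == n then d.+1 else p i.
have pq i : (i < n)%N -> p i = q i by move=> lin; rewrite /q ltn_eqF.
have aq : admissible_upto q n.+1.
  move=> i; rewrite ltnS leq_eqVlt => /predU1P[->|lin].
    by rewrite -(eq_r _ _ _ pq) /q eqxx addn1 ltnS.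
  exact: (eq_admissible_upto _ _ _ pq ap).
exists q; split => //; rewrite /cylinder/= in_itv/= highS// lowS /flipped/=.
rewrite -(eq_r _ _ _ pq) -(eq_low _ _ _ _ pq) -(eq_width _ _ _ pq) -/a.
have -> : q n = d.+1 by rewrite /q eqxx.
have d1 : 1 <= d%:R :> R by rewrite (le_trans a0)// ler_nat.
rewrite xE ltrD2l lerD2l ltr_pM2l// ler_pM2l// -natr1 addrK.
move: td dt; rewrite -natr1 ltr_pdivrMr// ler_pdivlMr// => td dt.
by rewrite ltr_pdivrMr ?ler_pdivlMr; lra.
Qed.

(** Words of different lengths describing the same point agree on their common
part, so they are the prefixes of a single infinite sequence. *)
Lemma cylinders_glue alt x :
  (forall n, exists p, admissible_upto p n /\ cylinder alt p n x) ->
  exists p, admissible phi p /\ forall n, cylinder alt p n x.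
Proof.
move=> /choice[P PP].
have Pp n i : (i < n)%N -> P n i = P i.+1 i.
  move=> lin; have [an xn] := PP n; have [ai xi] := PP i.+1.
  apply: (cylinder_inj alt _ _ i.+1 x) => //.
    exact: admissible_upto_le an.
  exact: cylinder_le xn.
exists (fun i => P i.+1 i); split => [n|n].
  exact: (eq_admissible_upto _ _ _ (Pp n.+1) (PP n.+1).1).
by rewrite -(eq_cylinder _ _ _ _ (Pp n)); exact: (PP n).2.
Qed.

Lemma cylinder0 alt p : cylinder alt p 0 = `]0, 1]%classic.
Proof. by rewrite /cylinder /low /width !big_ord0 add0r. Qed.

(** * The map exchanging the two representations *)

Lemma P_digitsP x : `]0, 1]%classic x -> admissible phi (P_digits phi x) /\
  forall n, cylinder false (P_digits phi x) n x.
Proof.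
move=> x01.
have [p [ap px]] : exists p, admissible phi p /\ forall n, cylinder false p n x.
  apply: cylinders_glue; elim=> [|n [p [ap px]]]; last exact: next_P_digit px.
  by exists (fun=> 0%N); rewrite cylinder0.
have [] : admissible phi (P_digits phi x) /\ DeltaP phi (P_digits phi x) = x.
  apply: (@xgetPex _ _ [set p | admissible phi p /\ DeltaP phi p = x]).
  by exists p; split => //; exact: (cylinders_Delta false).
move=> aP Px; split => // n; rewrite -[X in cylinder _ _ _ X]Px.
exact: (Delta_cylinder false).
Qed.

Lemma F_P_cylinder x n : `]0, 1]%classic x ->
  cylinder true (P_digits phi x) n (F_P phi x).
Proof. by move=> /P_digitsP[aP _]; exact: (Delta_cylinder true). Qed.

(** The digits of [DeltaP phi p] are [p] itself, by uniqueness: both sequences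
have the point in all their intervals. *)
Lemma F_P_DeltaP p : admissible phi p ->
  F_P phi (DeltaP phi p) = DeltaPminus phi p :> R.
Proof.
move=> ap; have px n : cylinder false p n (DeltaP phi p).
  exact: (Delta_cylinder false).
have x01 : `]0, 1]%classic (DeltaP phi p : R) by rewrite -(cylinder0 false p).
have [aP Px] := P_digitsP _ x01.
rewrite /F_P; congr DeltaPminus; apply/funext => i.
by apply: (cylinder_inj false _ _ i.+1 _ _ _ (Px _) (px _)) => //;
  exact: admissible_admissible_upto.
Qed.

Definition word_cylinder alt (w : seq nat) : set R :=
  cylinder alt (nth 0%N w) (size w).

Definition admissible_word (w : seq nat) := admissible_upto (nth 0%N w) (size w).

Lemma admissible_mkseq p n : admissible_upto p n -> admissible_word (mkseq p n).
Proof.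
rewrite /admissible_word size_mkseq; apply: eq_admissible_upto => i lin.
by rewrite nth_mkseq.
Qed.

Lemma word_cylinder_mkseq alt p n : word_cylinder alt (mkseq p n) = cylinder alt p n.
Proof.
rewrite /word_cylinder size_mkseq; apply: eq_cylinder => i lin.
by rewrite nth_mkseq.
Qed.

(** The image is a countable intersection of countable unions of intervals,
because a point lying in a P^- -interval of every rank has an infinite digit
sequence, which is also the digit sequence of a point of ]0, 1]. *)
Lemma measurable_image_F_P : measurable (F_P phi @` `]0, 1]%classic : set R).
Proof.
rewrite [X in measurable X](_ : _ = \bigcap_n
  \bigcup_(w in [set w | size w = n /\ admissible_word w]) word_cylinder true w).
  apply: bigcapT_measurable => n.
  rewrite bigcup_mkcond; apply: countable_bigcupT_measurable => [|w].
    exact: countableP.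
  by case: ifP => _ //; exact: measurable_itv.
apply/seteqP; split => [_ [x x01 <-] n _|y yn].
  exists (mkseq (P_digits phi x) n).
    rewrite /= size_mkseq; split => //; apply: admissible_mkseq.
    exact: (admissible_admissible_upto _ _ (P_digitsP x x01).1).
  by rewrite word_cylinder_mkseq; exact: F_P_cylinder.
have [n|p [ap py]] := @cylinders_glue true y.
  by have [w [<- aw] yw] := yn n I; exists (nth 0%N w).
exists (DeltaP phi p); first by rewrite -(cylinder0 false p); exact: (Delta_cylinder false).
by rewrite F_P_DeltaP//; exact: (cylinders_Delta true).
Qed.

(** * Comparison of outer measures *)

(** Words of the maximal intervals contained in [U]. *)
Definition minimal_word alt (U : set R) w := [/\ admissible_word w,
  word_cylinder alt w `<=` U &
  forall k, (k < size w)%N -> ~ (cylinder alt (nth 0%N w) k `<=` U)].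

(** If two minimal words share a point, one is a prefix of the other, and
minimality forbids a proper prefix. *)
Lemma minimal_word_disjoint alt U w w' x :
  minimal_word alt U w -> minimal_word alt U w' ->
  word_cylinder alt w x -> word_cylinder alt w' x -> w = w'.
Proof.
wlog : w w' / (size w <= size w')%N.
  move=> H mw mw' wx wx'; have [ww'|/ltnW ww'] := leqP (size w) (size w').
    exact: H.
  by apply/esym; exact: H.
move=> ww' [aw wU _] [aw' _ mw'] wx wx'.
have e i : (i < size w)%N -> nth 0%N w i = nth 0%N w' i.
  apply: (cylinder_inj alt _ _ _ x) => //; first exact: admissible_upto_le aw'.
  exact: cylinder_le wx'.
move: ww'; rewrite leq_eqVlt => /predU1P[ww'|/mw']; first exact: eq_from_nth ww' e.
by rewrite -(eq_cylinder _ _ _ _ e).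
Qed.

Lemma exists_minimal_word alt p x (U : set R) : admissible phi p ->
  (forall n, cylinder alt p n x) -> open U -> U x ->
  exists n, minimal_word alt U (mkseq p n).
Proof.
move=> ap px oU Ux.
have [m mU] := small_cylinder _ _ _ _ ap px oU Ux.
have ex : exists n, `[< cylinder alt p n `<=` U >] by exists m; exact/asboolP.
case: (ex_minnP ex) => n /asboolP nU nmin.
exists n; split.
- exact/admissible_mkseq/admissible_admissible_upto.
- by rewrite word_cylinder_mkseq.
rewrite size_mkseq => k kn kU; have : (n <= k)%N.
  apply: nmin; apply/asboolP; rewrite (@eq_cylinder _ p (nth 0%N (mkseq p n)))// => i ik.
  by rewrite nth_mkseq// (ltn_trans ik).
by rewrite leqNgt kn.
Qed.

(** The maximal intervals of one family contained in a tight open neighbourhood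
of [S] are disjoint, which bounds their total length; the intervals of the
other family with the same words cover [T] at the same cost.  Both families are used in turn, which is why [alt] is arbitrary. *)
Lemma outer_measure_transfer alt (S T : set R) :
  (forall y, T y -> exists x p, [/\ S x, admissible phi p,
     forall n, cylinder alt p n x & forall n, cylinder (~~ alt) p n y]) ->
  (lebesgue_measure T <= lebesgue_measure S)%E.
Proof.
move=> TS; apply/lee_addgt0Pr => e e0.
have [U [oU SU Ue]] := @outer_measure_open_le _ S e e0.
apply: le_trans Ue.
(* [pickle_inv] enumerates the words without repetition, as disjointness of
   the sequence of intervals requires. *)
pose g b n : set R := if pickle_inv n is Some w then
  if `[< minimal_word alt U w >] then word_cylinder b w else set0 else set0.
have gE b w : minimal_word alt U w -> g b (pickle w) = word_cylinder b w.
  by move=> mw; rewrite /g pickleK_inv asboolT.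
have gP b n x : g b n x ->
    exists w, [/\ n = pickle w, minimal_word alt U w & word_cylinder b w x].
  rewrite /g; case: pickle_inv (@pickle_invK (seq nat) n) => //= w <-.
  by case: asboolP => // mw wx; exists w.
have mg b n : measurable (g b n).
  by rewrite /g; case: pickle_inv => // w; case: asboolP => // _; exact: measurable_itv.
have lg n : lebesgue_measure (g (~~ alt) n) = lebesgue_measure (g alt n).
  rewrite /g; case: pickle_inv => // w; case: asboolP => // -[aw _ _].
  by rewrite !lebesgue_measure_cylinder.
have tg : trivIset setT (g alt).
  move=> i j _ _ [x [/gP[w [-> mw wx]] /gP[w' [-> mw' wx']]]].
  by rewrite (minimal_word_disjoint alt U w w' x).
have gU : \bigcup_n g alt n `<=` U.
  by move=> x [n _ /gP[w [_ [_ wU _] /wU]]].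
have Tg : T `<=` \bigcup_n g (~~ alt) n.
  move=> y /TS[x [p [Sx ap px py]]].
  have [n mn] := exists_minimal_word _ _ _ _ ap px oU (SU _ Sx).
  by exists (pickle (mkseq p n)) => //; rewrite gE// word_cylinder_mkseq.
have := @outer_measure_sigma_subadditive _ _ ((@wlength R idfun)^*)%mu (g (~~ alt)).
move=> H; apply: (le_trans (le_outer_measure ((@wlength R idfun)^*)%mu _ _ Tg)).
apply: (le_trans H).
rewrite (eq_eseriesr (g := fun n => lebesgue_measure (g alt n))); last first.
  by move=> n _; exact: lg.
apply: (@le_trans _ _ (lebesgue_measure (\bigcup_n g alt n))).
  rewrite measure_bigcup//; last by move=> n _; exact: mg.
  by rewrite [leRHS](eq_eseriesl (Q := xpredT))// => n; rewrite in_setT.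
exact: (le_outer_measure ((@wlength R idfun)^*)%mu _ _ gU).
Qed.

End Cylinders.

(** * Images of measurable sets *)

Theorem theorem5p1 (R : realType) (phi : rule) (hphi : rule_pos phi)
    (E : set R) (hE : E `<=` `]0, 1]%classic) (mE : lebesgue_measurable E) :
  lebesgue_measurable (F_P phi @` E) /\
  completed_lebesgue_measure (F_P phi @` E) = completed_lebesgue_measure E.
Proof.
pose mu := ((@wlength R idfun)^*)%mu.
pose I01 : set R := `]0, 1]%classic.
have le_image (X : set R) : X `<=` I01 -> (mu (F_P phi @` X) <= mu X)%E.
  move=> X01; apply: (outer_measure_transfer phi hphi false) => _ [x Xx <-].
  have [aP Px] := P_digitsP phi hphi x (X01 _ Xx).
  exists x, (P_digits phi x); split => // n.
  exact: F_P_cylinder (X01 _ Xx).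
have le_preimage (Y : set R) : (mu (F_P phi @^-1` Y `&` I01) <= mu Y)%E.
  apply: (outer_measure_transfer phi hphi true) => x [Yx x01].
  have [aP Px] := P_digitsP phi hphi x x01.
  exists (F_P phi x), (P_digits phi x); split => // n.
  exact: F_P_cylinder x01.
split; last first.
  (* The lower bound comes from the preimage of [F_P phi @` E], which
     contains [E]. *)
  apply/eqP; rewrite eq_le; apply/andP; split; first exact: le_image.
  apply: le_trans (le_preimage _); apply: le_outer_measure => x Ex.
  by split; [exists x|exact: hE].
suff cara A : (mu (A `&` F_P phi @` E) + mu (A `&` ~` (F_P phi @` E)) <= mu A)%E.
  by apply: le_caratheodory_measurable => A; exact: cara.
pose J := F_P phi @` I01.
have mJ : mu.-cara.-measurable J.
  exact: (sub_caratheodory _ (measurable_image_F_P phi hphi)).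
pose A' := F_P phi @^-1` A `&` I01.
have A'01 : A' `<=` I01 by move=> x [].
have AE : A `&` F_P phi @` E `<=` F_P phi @` (A' `&` E).
  move=> y [Ay [x Ex xy]]; exists x => //.
  by split => //; split; [rewrite /= xy|exact: hE].
have AnE : A `&` ~` (F_P phi @` E) `<=` F_P phi @` (A' `&` ~` E) `|` (A `&` ~` J).
  move=> y [Ay nEy]; have [[x x01 xy]|nJy] := pselect (J y); last by right.
  left; exists x => //; split; first by split; rewrite //= xy.
  by move=> Ex; apply: nEy; exists x.
have -> : mu A = (mu (A `&` J) + mu (A `&` ~` J))%E by exact: mJ.
apply: (@le_trans _ _ (mu (A' `&` E) + (mu (A' `&` ~` E) + mu (A `&` ~` J)))%E).
  apply: leeD.
    apply: (le_trans (le_outer_measure mu _ _ AE)).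
    by apply: le_image => x [A'x _]; exact: A'01.
  apply: (le_trans (le_outer_measure mu _ _ AnE)).
  apply: (le_trans (outer_measureU2 mu _ _)).
  by apply: leeD => //; apply: le_image => x [A'x _]; exact: A'01.
rewrite addeA; apply: leeD => //.
have <- : mu A' = (mu (A' `&` E) + mu (A' `&` ~` E))%E by exact: mE.
apply: le_trans (le_preimage _); apply: le_outer_measure => x [Ax x01].
by split => //; split => //; exists x.
Qed.
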